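(* Let $X$ be a topological space, let $Y$ be a compact regular Hausdorff space and let $f : X \to Y$ be a function. Let $Z := \mathrm{cl}(\mathrm{gr}(f)) \subseteq X \times Y$ denote the closure of the graph $\mathrm{gr}(f) = \{(x,f(x)) : x \in X\}$ of $f$ in $X \times Y$. Then the following two conditions are equivalent. (1) $f : X \to Y$ is globally multi-split continuous. (2) The restriction to $Z$ of the standard projection $\pi : X \times Y \to X$ is finite-to-one.
   Context: A neighborhood of a point $p$ (respectively of a subset $S$) in a topological space is a set $V$, not necessarily open, for which there is an open set $U$ with $p \in U \subseteq V$ (respectively $S \subseteq U \subseteq V$). Let $f : X \to Y$ be a function between topological spaces and $p \in X$. The function $f$ is multi-split continuous at $p$ if there exists a finite non-empty set $Z_p \subseteq Y$ such that: (a) for every $y \in Z_p$ and all neighborhoods $U \subseteq X$ of $p$ and $V \subseteq Y$ of $y$ one has $f(U) \cap V \neq \varnothing$; (b) for every neighborhood $V \subseteq Y$ of the set $Z_p$ there exists a neighborhood $U \subseteq X$ of $p$ with $f(U) \subseteq V$. The function $f$ is globally multi-split continuous if it is multi-split continuous at every $p \in X$. A map is finite-to-one if every point of its codomain has a finite preimage. $X \times Y$ carries the product topology. *)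

(* Defs.v *)
From mathcomp Require Import all_boot.
From mathcomp Require Import all_classical topology.

Set Implicit Arguments.
Unset Strict Implicit.
Unset Printing Implicit Defensive.

Local Open Scope classical_set_scope.

(* Neighborhoods need not be open: [nbhs p] is the filter of all neighborhoods
   of [p], and [set_nbhs Zp] that of all neighborhoods of the set [Zp], i.e.
   of the supersets of some open superset of [Zp] (see [set_nbhsP]). *)
Definition multi_split_continuous_at (X Y : topologicalType) (f : X -> Y)
    (p : X) : Prop :=
  exists Zp : set Y,
    [/\ finite_set Zp,
        Zp !=set0,
        forall y, Zp y -> forall (U : set X) (V : set Y),
          nbhs p U -> nbhs y V -> (f @` U) `&` V !=set0
      & forall V : set Y, set_nbhs Zp V ->
          exists2 U : set X, nbhs p U & f @` U `<=` V].

Definition globally_multi_split_continuous (X Y : topologicalType)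
    (f : X -> Y) : Prop :=
  forall p : X, multi_split_continuous_at f p.

Definition graph (X Y : Type) (f : X -> Y) : set (X * Y) :=
  [set (x, f x) | x in [set: X]].

Definition finite_to_one (A B : Type) (g : A -> B) : Prop :=
  forall b : B, finite_set (g @^-1` [set b]).

(* Main.v *)
Require Import Defs.
From mathcomp Require Import all_boot.
From mathcomp Require Import all_classical topology.

Local Open Scope classical_set_scope.

(** Both conditions say that, at every point [p], the set [cluster (f @ p)] of
    cluster points of [f] along the neighborhoods of [p] is finite.

    A point [y] belongs to this set exactly when [(p, y)] lies in the closure
    of the graph ([closure_graphE]), because the rectangles form a basis of the
    product topology. So the fiber over [p] of the projection restricted to the
    closed graph is a copy of [cluster (f @ p)] ([finite_fiberP]).

    On the other side, clause (a) of multi-split continuity says that the set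
    [Zp] consists of cluster points, and clause (b) that the images of small
    neighborhoods of [p] concentrate around [Zp]. In a regular Hausdorff space
    a point outside the finite, hence closed, set [Zp] is separated from [Zp]
    by neighborhoods, so clause (b) prevents it from being a cluster point;
    this bounds [cluster (f @ p)] by [Zp] ([cluster_sub_closed]). Conversely,
    in a compact space the cluster points of a filter form a nonempty set, each
    neighborhood of which belongs to the filter ([compact_cluster_nbhs]): the
    whole of [cluster (f @ p)], once finite, therefore serves as [Zp]. *)

(** The trace of [F] on the complement of [V] has no cluster point: it would be
    a cluster point of [F], and [V] would then be one of its neighborhoods,
    disjoint from the complement of [V]. By compactness that trace is not a
    proper filter, that is, [V] belongs to [F]. *)
Lemma compact_cluster_nbhs (T : topologicalType) (F : set_system T)
    (V : set T) :
  compact [set: T] -> Filter F -> set_nbhs (cluster F) V -> F V.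
Proof.
move=> cptT FF clFV; apply: contrapT => nFV.
have PG : ProperFilter (within (~` V) F).
  apply: Build_ProperFilter_ex => A GA; apply: contrapT => A0; apply: nFV.
  move: GA; rewrite /within /=; apply: filterS => y VCA.
  by apply: contrapT => /VCA Ay; apply: A0; exists y.
have [z [_ Gz]] := cptT _ PG filterT.
have Fz : cluster F z by apply: cvg_cluster Gz; exact: cvg_within.
have [y [/= nVy Vy]] := Gz _ _ (withinT (~` V) FF) (clFV z Fz).
exact: nVy.
Qed.

(** By regularity, a point off [C] has a closed neighborhood missing [C]; its
    complement is a neighborhood of [C], so belongs to [F], and keeps [F] away
    from the point. *)
Lemma cluster_sub_closed (T : topologicalType) (F : set_system T)
    (C : set T) :
  regular_space T -> closed C -> set_nbhs C `<=` F -> cluster F `<=` C.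
Proof.
move=> regT clC CF y Fy; apply: contrapT => nCy.
have [B By BC] : filter_from (nbhs y) closure (~` C).
  by apply: regT; apply: open_nbhs_nbhs; split=> //; exact: closed_openC.
have FB : F (~` closure B).
  apply: CF => z Cz; apply: open_nbhs_nbhs; split.
    exact/closed_openC/closed_closure.
  by move=> /BC.
have [z [nBz Bz]] := Fy _ _ FB By.
exact/nBz/subset_closure.
Qed.

Lemma closure_graphE (X Y : topologicalType) (f : X -> Y) (p : X) (y : Y) :
  closure (graph f) (p, y) <-> cluster (f @ p) y.
Proof.
split=> [cly A B /= pA yB | cly W [[A B] [/= pA yB] ABW]].
  have [_ [[x _ <-] /= [Ax Bfx]]] : graph f `&` ((f @^-1` A) `*` B) !=set0.
    by apply: cly; exists (f @^-1` A, B).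
  by exists (f x).
have fpA : (f @ p) (f @` A) by apply: filterS pA => x Ax; exists x.
have [_ [[x Ax <-] Bfx]] := cly _ _ fpA yB.
by exists (x, f x); split; [exists x | exact: ABW].
Qed.

Lemma finite_fiberP (X Y : topologicalType) (f : X -> Y) (p : X) :
  finite_set (sigL (closure (graph f)) (@fst X Y) @^-1` [set p]) <->
  finite_set (cluster (f @ p)).
Proof.
split=> [finp | fincl].
  apply: sub_finite_set (finite_image (fun z => (set_val z).2) finp).
  by move=> y /closure_graphE/mem_set py; exists (SigSub py).
apply: (@sub_finite_set _ _ (set_val @^-1` ([set p] `*` cluster (f @ p)))).
  move=> z /= zp; split=> //=; apply/closure_graphE.
  by rewrite -zp -surjective_pairing; exact: set_valP.
apply: finite_preimage; first by move=> ? ? _ _; exact: val_inj.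
exact: finite_setX.
Qed.

Lemma multi_split_continuous_atP (X Y : topologicalType) (f : X -> Y) (p : X) :
  compact [set: Y] -> regular_space Y -> hausdorff_space Y ->
  multi_split_continuous_at f p <-> finite_set (cluster (f @ p)).
Proof.
move=> cptY regY hsY; split=> [[Zp [finZ _ _ ZpV]] | fincl].
  apply: (sub_finite_set _ finZ); apply: cluster_sub_closed => //.
    apply: (accessible_finite_set_closed.1 _ _ finZ).
    exact: hausdorff_accessible.
  by move=> V /ZpV[U pU fUV]; apply: filterS pU => x Ux; apply: fUV; exists x.
exists (cluster (f @ p)); split=> //.
- have [y [_ cly]] := cptY (f @ p) _ filterT.
  by exists y.
- move=> y cly U V pU yV; apply: cly => //.
  by apply: filterS pU => x Ux; exists x.
- move=> V clV; exists (f @^-1` V); last exact: image_preimage_subset.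
  exact: (@compact_cluster_nbhs _ (f @ p)).
Qed.

(* [sigL Z fst : Z -> X] is the restriction of the first projection to [Z]. *)
Theorem proposition5p7 (X Y : topologicalType) (f : X -> Y)
  (Ycompact : compact [set: Y]) (Yregular : regular_space Y)
  (Yhausdorff : hausdorff_space Y) :
  globally_multi_split_continuous f <->
  finite_to_one (sigL (closure (graph f)) (@fst X Y)).
Proof.
split=> H p.
  exact/finite_fiberP/multi_split_continuous_atP.
exact/multi_split_continuous_atP/finite_fiberP.
Qed.
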